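(* Let $f\colon\mathbb{H}_1\to\mathbb{H}_2$ be a relatively algebraically closed homomorphism of hyperfields. Then for every ordered abelian group $\Gamma$, the induced homomorphism $f^\Gamma\colon\mathbb{H}_1\rtimes\Gamma\to\mathbb{H}_2\rtimes\Gamma$ is relatively algebraically closed.
   Context: **Hyperfields.** A hyperoperation on a set $H$ is a map $\boxplus$ from $H\times H$ to the non-empty subsets of $H$; for subsets, $A\boxplus B=\bigcup_{a\in A,b\in B}a\boxplus b$, singletons are identified with their elements, and longer hypersums are obtained by iteration. A hyperfield is a tuple $(\mathbb{H},\boxplus,\odot,0_{\mathbb H},1_{\mathbb H})$ such that: $\boxplus$ is an associative and commutative hyperoperation; $0_{\mathbb H}\boxplus a=a$; each $a$ has a unique $-a$ with $0_{\mathbb H}\in a\boxplus(-a)$; $a\in b\boxplus c$ iff $c\in a\boxplus(-b)$; $\mathbb{H}^\times:=\mathbb{H}\setminus\{0_{\mathbb H}\}$ is an abelian group under the single-valued operation $\odot$ with identity $1_{\mathbb H}$; $a\odot(b\boxplus c)=(a\odot b)\boxplus(a\odot c)$; and $0_{\mathbb H}\odot a=0_{\mathbb H}$. **Tropical extension.** For a hyperfield $\mathbb{H}$ and a (totally) ordered abelian group $(\Gamma,+)$, $\mathbb{H}\rtimes\Gamma$ is the hyperfield with underlying set $\{(c,g)\mid c\in\mathbb{H}^\times,g\in\Gamma\}\cup\{\mathbb 0\}$, zero element $\mathbb 0$, multiplication $(c_1,g_1)\odot(c_2,g_2)=(c_1\odot_{\mathbb H}c_2,g_1+g_2)$, and addition: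 $(c_1,g_1)\boxplus(c_2,g_2)$ equals $(c_1,g_1)$ if $g_1<g_2$; $(c_2,g_2)$ if $g_2<g_1$; $\{(c,g)\mid c\in c_1\boxplus_{\mathbb H}c_2\}$ if $g_1=g_2=g$ and $0_{\mathbb H}\notin c_1\boxplus_{\mathbb H} c_2$; and $\{(c,g)\mid c\in(c_1\boxplus_{\mathbb H}c_2)\setminus\{0_{\mathbb H}\}\}\cup\{(b,h)\mid h>g,b\in\mathbb{H}^\times\}\cup\{\mathbb 0\}$ if $g_1=g_2=g$ and $0_{\mathbb H}\in c_1\boxplus_{\mathbb H}c_2$. **Homomorphisms.** A hyperfield homomorphism $f\colon\mathbb{H}_1\to\mathbb{H}_2$ is a map with $f(a\boxplus_1 b)\subseteq f(a)\boxplus_2 f(b)$, $f(a\odot_1 b)=f(a)\odot_2 f(b)$, $f(0)=0$, $f(1)=1$. Its tropical extension by $\Gamma$ is $f^\Gamma(c,g)=(f(c),g)$, $f^\Gamma(\mathbb 0)=\mathbb 0$. **Univariate polynomials.** $\mathbb{H}[X]$ is the set of formal expressions $p=\boxplus_{d\in D}c_d\odot X^d$ with $D\subset\mathbb{Z}_{\ge0}$ finite and $c_d\in\mathbb{H}^\times$; $p(a)=\boxplus_{d\in D}c_d\odot a^d\subseteq\mathbb{H}$; $V(p)=\{a\in\mathbb{H}\mid 0_{\mathbb H}\in p(a)\}$. The push-forward along $f$ is $f_*(p)=\boxplus_{d\in D}f(c_d)\odot X^d$. **RAC.** A surjective hyperfield homomorphism $f\colon\mathbb{H}_1\to\mathbb{H}_2$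 is relatively algebraically closed if for every $p\in\mathbb{H}_1[X]$ and every $\beta\in V(f_*(p))$ there exists $\alpha\in f^{-1}(\beta)$ with $\alpha\in V(p)$. *)

(* Defs.v *)
From HB Require Import structures.
From mathcomp Require Import all_boot all_order all_algebra.
From mathcomp Require Import finmap.
From mathcomp Require Import boolp classical_sets.

Set Implicit Arguments.
Unset Strict Implicit.
Unset Printing Implicit Defensive.

Import Order.TTheory GRing.Theory Num.Theory.

Local Open Scope classical_set_scope.

Declare Scope hyper_scope.
Delimit Scope hyper_scope with H.
Local Open Scope hyper_scope.

Reserved Notation "a ⊞ b" (at level 50, left associativity).
Reserved Notation "a ⊙ b" (at level 40, left associativity).

(* Extension of a hyperoperation to subsets. *)
Definition hyperlift (T : Type) (op : T -> T -> set T) (A B : set T) : set T :=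
  \bigcup_(a in A) \bigcup_(b in B) op a b.

(* Multiplication is total, but its group axioms are only required on the     *)
(* nonzero elements.                                                          *)
HB.mixin Record isHyperfield H := {
  hzero : H;
  hone : H;
  hopp : H -> H;
  hadd : H -> H -> set H;
  hmul : H -> H -> H;
  hadd_nonempty : forall a b, hadd a b !=set0;
  haddA : forall a b c,
    hyperlift hadd (hadd a b) [set c] = hyperlift hadd [set a] (hadd b c);
  haddC : forall a b, hadd a b = hadd b a;
  hadd0 : forall a, hadd hzero a = [set a];
  haddN : forall a, hadd a (hopp a) hzero;
  hopp_uniq : forall a b, hadd a b hzero -> b = hopp a;
  hadd_rev : forall a b c, hadd b c a <-> hadd a (hopp b) c;
  hone_neq0 : hone <> hzero;
  hmul_neq0 : forall a b, a <> hzero -> b <> hzero -> hmul a b <> hzero;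
  hmulA : forall a b c, a <> hzero -> b <> hzero -> c <> hzero ->
    hmul a (hmul b c) = hmul (hmul a b) c;
  hmulC : forall a b, a <> hzero -> b <> hzero -> hmul a b = hmul b a;
  hmul1 : forall a, a <> hzero -> hmul hone a = a;
  hmulV : forall a, a <> hzero -> exists2 b, b <> hzero & hmul b a = hone;
  hmulD : forall a b c, hmul a @` hadd b c = hadd (hmul a b) (hmul a c);
  hmul0 : forall a, hmul hzero a = hzero
}.

#[short(type="hyperfieldType")]
HB.structure Definition Hyperfield := { H of isHyperfield H }.

Arguments hopp_uniq {s} [a b] _.
Arguments hmul_neq0 {s} [a b] _ _ _.
Arguments hmulA {s} [a b c] _ _ _.
Arguments hmulC {s} [a b] _ _.
Arguments hmul1 {s} [a] _.
Arguments hmulV {s} [a] _.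

Notation "a ⊞ b" := (hadd a b) : hyper_scope.
Notation "a ⊙ b" := (hmul a b) : hyper_scope.

Definition hunits (H : hyperfieldType) : Type := {c : H | c <> hzero}.

Lemma hunitP (H : hyperfieldType) (c : hunits H) : sval c <> hzero.
Proof. by case: c. Qed.

HB.mixin Record isHyperfieldHom (H1 H2 : hyperfieldType) (f : H1 -> H2) := {
  hhomD : forall a b, f @` (a ⊞ b) `<=` f a ⊞ f b;
  hhomM : forall a b, f (a ⊙ b) = f a ⊙ f b;
  hhom0 : f hzero = hzero;
  hhom1 : f hone = hone
}.

HB.structure Definition HyperfieldHom (H1 H2 : hyperfieldType) :=
  { f of isHyperfieldHom H1 H2 f }.

Notation "{ 'hyperhom' H1 -> H2 }" := (HyperfieldHom.type H1 H2)
  (at level 0, H1 at level 98, H2 at level 99,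
   format "{ 'hyperhom'  H1  ->  H2 }") : type_scope.

Lemma hhom_neq0 (H1 H2 : hyperfieldType) (f : {hyperhom H1 -> H2}) (c : H1) :
  c <> hzero -> f c <> hzero.
Proof.
move=> c0 fc0; have [b b0 bc] := hmulV c0.
by apply: (@hone_neq0 H2); rewrite -(@hhom1 _ _ f) -bc hmulC // hhomM fc0 hmul0.
Qed.

Definition hunits_map (H1 H2 : hyperfieldType) (f : {hyperhom H1 -> H2})
    (c : hunits H1) : hunits H2 :=
  exist _ (f (sval c)) (hhom_neq0 (svalP c)).

(* A finite set D of exponents ([domf p]) with a nonzero coefficient for each *)
(* d in D; D may be empty.                                                    *)
Definition hpoly (H : hyperfieldType) : Type := {fmap nat -> hunits H}.

Definition hexp (H : hyperfieldType) (a : H) (n : nat) : H :=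
  iter n (hmul a) hone.

(* [hyperlift hadd] is associative and commutative with neutral element {0},  *)
(* so the order of summation is irrelevant; the empty hypersum is {0}.        *)
Definition heval (H : hyperfieldType) (p : hpoly H) (a : H) : set H :=
  \big[hyperlift (@hadd H)/[set hzero]]_(d : domf p)
    [set sval (p d) ⊙ hexp a (val d)].

Definition hroots (H : hyperfieldType) (p : hpoly H) : set H :=
  [set a | heval p a hzero].

Definition hpush (H1 H2 : hyperfieldType) (f : {hyperhom H1 -> H2})
    (p : hpoly H1) : hpoly H2 :=
  [fmap d : domf p => hunits_map f (p d)]%fmap.

Definition relatively_algebraically_closed (H1 H2 : hyperfieldType)
    (f : {hyperhom H1 -> H2}) : Prop :=
  (forall b : H2, exists a : H1, f a = b) /\
  (forall (p : hpoly H1) (b : H2), hroots (hpush f p) b ->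
     exists2 a : H1, f a = b & hroots p a).

(* The order of a [porderZmodType] is partial and unrelated to the group law. *)
HB.mixin Record isOrderedAbelianGroup G of Num.POrderedZmodule G := {
  le_total_oag : total (fun x y : G => x <= y)%R;
  leD2l_oag : forall z x y : G, (x <= y -> z + x <= z + y)%R
}.

#[short(type="orderedAbelianGroupType")]
HB.structure Definition OrderedAbelianGroup :=
  { G of isOrderedAbelianGroup G & Num.POrderedZmodule G }.

Lemma ltD2l_oag (G : orderedAbelianGroupType) (z x y : G) :
  (z + x < z + y)%R = (x < y)%R.
Proof.
rewrite !lt_def (inj_eq (addrI z)); congr andb.
apply/idP/idP; last exact: leD2l_oag.
by move/(leD2l_oag (- z)%R); rewrite !addKr.
Qed.

Definition ltgtP_oag (G : orderedAbelianGroupType) (x y : G) :=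
  comparable_ltgtP (le_total_oag x y : (x >=< y)%R).

Inductive trop (H : hyperfieldType) (G : orderedAbelianGroupType) : Type :=
| TZero
| TPair (c : hunits H) (g : G).
Arguments TZero {H G}.
Arguments TPair {H G}.

Section TropicalExtension.
Variables (H : hyperfieldType) (G : orderedAbelianGroupType).
Implicit Types (x y z w u v : trop H G) (c d e : hunits H) (g h : G).

Definition hunit_one : hunits H := exist _ hone (@hone_neq0 H).

Definition hunit_mul c d : hunits H :=
  exist _ (sval c ⊙ sval d) (hmul_neq0 (svalP c) (svalP d)).

Lemma hopp_neq0 (c : H) : c <> hzero -> hopp c <> hzero.
Proof.
move=> c0 e; have := haddN c; rewrite e haddC hadd0 => /esym; exact: c0.
Qed.

Definition hunit_opp c : hunits H :=
  exist _ (hopp (sval c)) (hopp_neq0 (svalP c)).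

(* When g1 = g2, an element of valuation g1 belongs to the sum iff its        *)
(* coefficient belongs to c1 ⊞ c2, while the zero element and everything of   *)
(* larger valuation belong to it exactly when c1 ⊞ c2 contains 0.             *)
Definition trop_add x y : set (trop H G) :=
  match x, y with
  | TZero, _ => [set y]
  | _, TZero => [set x]
  | TPair c1 g1, TPair c2 g2 =>
    if (g1 < g2)%R then [set x]
    else if (g2 < g1)%R then [set y]
    else [set z | match z with
         | TZero => (sval c1 ⊞ sval c2) hzero
         | TPair c g => (g = g1 /\ (sval c1 ⊞ sval c2) (sval c)) \/
                        ((g1 < g)%R /\ (sval c1 ⊞ sval c2) hzero)
         end]
  end.

Definition trop_mul x y : trop H G :=
  match x, y with
  | TPair c1 g1, TPair c2 g2 => TPair (hunit_mul c1 c2) (g1 + g2)%R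
  | _, _ => TZero
  end.

Definition trop_one : trop H G := TPair hunit_one 0%R.

Definition trop_opp x : trop H G :=
  if x is TPair c g then TPair (hunit_opp c) g else TZero.

Lemma hunits_inj c d : sval c = sval d -> c = d.
Proof.
by case: c d => [c c0] [d d0] /= e; subst; congr exist; exact: Prop_irrelevance.
Qed.

Lemma hadd_0r (a : H) : a ⊞ hzero = [set a].
Proof. by rewrite haddC hadd0. Qed.

Lemma hoppK (a : H) : hopp (hopp a) = a.
Proof. by apply/esym/hopp_uniq; rewrite haddC; exact: haddN. Qed.

Lemma hopp0 : hopp hzero = hzero :> H.
Proof. by apply/esym/hopp_uniq; rewrite hadd0. Qed.

Lemma haddA_ex (a b c u w : H) : (a ⊞ b) u -> (u ⊞ c) w ->
  exists2 v, (b ⊞ c) v & (a ⊞ v) w.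
Proof.
move=> abu ucw; have : hyperlift (@hadd H) (a ⊞ b) [set c] w.
  by exists u => //; exists c.
by rewrite haddA => -[_ -> [v bcv avw]]; exists v.
Qed.

Lemma hmulN0 (a : H) : a ⊙ hzero = hzero.
Proof.
have [->|a0] := pselect (a = hzero); first by rewrite hmul0.
have [//|z0] := pselect (a ⊙ hzero = hzero).
pose y := hopp (a ⊙ hzero); have y0 : y <> hzero by exact: hopp_neq0.
have [a' a'0 a'a] := hmulV a0.
pose t := a' ⊙ y; have at_ : a ⊙ t = y.
  by rewrite /t hmulA // (hmulC a0 a'0) a'a hmul1.
have := hmulD a t hzero; rewrite hadd_0r image_set1 at_ => e.
by have := haddN (a ⊙ hzero); rewrite -/y haddC -e /= => /esym/y0.
Qed.

Definition tabove g x : Prop := if x is TPair _ h then (g < h)%R else True.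

Lemma trop_addC x y : trop_add x y = trop_add y x.
Proof.
case: x y => [|c1 g1] [|c2 g2] //=.
case: (ltgtP_oag g1 g2) => // ->.
by apply/seteqP; split => -[|c g] /=; rewrite (haddC (sval c2)).
Qed.

Lemma trop_add0 x : trop_add TZero x = [set x]. Proof. by []. Qed.
Lemma trop_add0r x : trop_add x TZero = [set x].
Proof. by rewrite trop_addC. Qed.

Lemma trop_addl c g x : tabove g x -> trop_add (TPair c g) x = [set TPair c g].
Proof. by case: x => [|d h] //= ->. Qed.

Lemma trop_addr c g x : tabove g x -> trop_add x (TPair c g) = [set TPair c g].
Proof. by move=> ?; rewrite trop_addC trop_addl. Qed.

Lemma trop_addeq c1 c2 g : trop_add (TPair c1 g) (TPair c2 g) =
  [set z | match z with
           | TZero => (sval c1 ⊞ sval c2) hzero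
           | TPair c h => (h = g /\ (sval c1 ⊞ sval c2) (sval c)) \/
                          ((g < h)%R /\ (sval c1 ⊞ sval c2) hzero)
           end].
Proof. by rewrite /= ltxx. Qed.

Lemma trop_addeq_above c1 c2 g x : tabove g x ->
  trop_add (TPair c1 g) (TPair c2 g) x <-> (sval c1 ⊞ sval c2) hzero.
Proof.
rewrite trop_addeq; case: x => [|c h] //= gh; split; last by right.
by move=> [[e]|[]//]; move: gh; rewrite e ltxx.
Qed.

Lemma trop_addeq_level c1 c2 c g :
  trop_add (TPair c1 g) (TPair c2 g) (TPair c g)
    <-> (sval c1 ⊞ sval c2) (sval c).
Proof.
rewrite trop_addeq /= ltxx; split; last by left.
by move=> [[]|[]].
Qed.

Variant trop_addeq_spec c1 c2 g : trop H G -> Prop :=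
| TropAddLevel c of (sval c1 ⊞ sval c2) (sval c) :
    trop_addeq_spec c1 c2 g (TPair c g)
| TropAddAbove x of tabove g x & (sval c1 ⊞ sval c2) hzero :
    trop_addeq_spec c1 c2 g x.

Lemma trop_addeqP c1 c2 g x : trop_add (TPair c1 g) (TPair c2 g) x ->
  trop_addeq_spec c1 c2 g x.
Proof.
rewrite trop_addeq; case: x => [|c h] /=; first by right.
by move=> [[-> ?]|[? ?]]; [left|right].
Qed.

Lemma trop_add_above g x y w :
  tabove g x -> tabove g y -> trop_add x y w -> tabove g w.
Proof.
case: x => [|c1 g1]; first by move=> _ ? ->.
case: y => [|c2 g2]; first by rewrite trop_add0r => ? _ ->.
move=> /= gg1 gg2; case: (ltgtP_oag g1 g2) => [?|?|e] /=; [by move=> -> | by move=> -> |].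
case: w => [|c h] //= [[-> _]//|[+ _]]; exact: lt_trans.
Qed.

Lemma trop_add_nonempty x y : trop_add x y !=set0.
Proof.
case: x => [|c1 g1]; first by exists y.
case: y => [|c2 g2]; first by eexists.
case: (ltgtP_oag g1 g2) => [l|l|<-]; first by rewrite trop_addl //; eexists.
  by rewrite trop_addr //; eexists.
have [a ha] := hadd_nonempty (sval c1) (sval c2).
have [a0|a0] := pselect (a = hzero).
  by move: ha; rewrite a0 => ?; exists TZero; exact/trop_addeq_above.
by exists (TPair (exist _ a a0) g1); apply/trop_addeq_level.
Qed.

Lemma trop_oppK x : trop_opp (trop_opp x) = x.
Proof. by case: x => //= c g; congr TPair; apply: hunits_inj; exact: hoppK. Qed.

Lemma trop_addN x : trop_add x (trop_opp x) TZero.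
Proof. by case: x => //= c g; rewrite ltxx; exact: haddN. Qed.

Lemma trop_opp_uniq x y : trop_add x y TZero -> y = trop_opp x.
Proof.
case: x y => [|c1 g1] [|c2 g2] //=.
case: (ltgtP_oag g1 g2) => [//|//|->] /hopp_uniq e.
by congr TPair; exact: hunits_inj.
Qed.

Lemma trop_add_rev1 x y z : trop_add y z x -> trop_add x (trop_opp y) z.
Proof.
case: y => [|c2 g2]; first by move=> ->; rewrite trop_add0r.
case: z => [|c3 g3]; first by rewrite trop_add0r => ->; exact: trop_addN.
case: (ltgtP_oag g2 g3) => [l|l|<-].
- rewrite trop_addl // => ->; apply/trop_addeq_above => //; exact: haddN.
- by rewrite trop_addr // => ->; rewrite [trop_opp _]/= trop_addl.
- case/trop_addeqP => [c h|{}x xa h].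
    rewrite [trop_opp _]/=; apply/trop_addeq_level.
    exact: (proj1 (hadd_rev _ _ _)).
  rewrite [trop_opp _]/= trop_addr //; congr TPair; apply: hunits_inj => /=.
  exact: hopp_uniq.
Qed.

Lemma trop_add_rev x y z : trop_add y z x <-> trop_add x (trop_opp y) z.
Proof.
split; first exact: trop_add_rev1.
rewrite trop_addC => /trop_add_rev1; rewrite trop_oppK.
by rewrite trop_addC.
Qed.

Lemma trop_addA1 x y z u w : trop_add x y u -> trop_add u z w ->
  exists2 v, trop_add y z v & trop_add x v w.
Proof.
case: x => [|c1 g1]; first by move=> -> h; exists w.
case: y => [|c2 g2]; first by rewrite trop_add0r => -> h; exists z.
case: z => [|c3 g3].
  by move=> h; rewrite trop_add0r => ->; exists (TPair c2 g2).
case: (ltgtP_oag g1 g2) => [l12|l21|<-{g2}].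
- rewrite trop_addl // => ->.
  case: (ltgtP_oag g1 g3) => [l13|l31|<-{g3}].
  + have [v hv] := trop_add_nonempty (TPair c2 g2) (TPair c3 g3).
    have va : tabove g1 v by apply: trop_add_above hv.
    by rewrite trop_addl // => ->; exists v => //; rewrite trop_addl.
  + have l32 := lt_trans l31 l12.
    by move=> h; exists (TPair c3 g3) => //; rewrite trop_addr.
  + by move=> h; exists (TPair c3 g1) => //; rewrite trop_addr.
- rewrite trop_addr // => ->.
  case: (ltgtP_oag g2 g3) => [l23|l32|<-{g3}].
  + by rewrite trop_addl // => ->; exists (TPair c2 g2) => //; rewrite trop_addr.
  + have l31 := lt_trans l32 l21.
    by rewrite trop_addr // => ->; exists (TPair c3 g3); rewrite // trop_addr.
  + case/trop_addeqP => [c h|{}w wa h].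
      by exists (TPair c g2); [exact/trop_addeq_level|rewrite trop_addr].
    have [v hv] := trop_add_nonempty w (trop_opp (TPair c1 g1)).
    have va : tabove g2 v by apply: trop_add_above hv.
    by exists v; [exact/trop_addeq_above|exact/trop_add_rev].
- case: (ltgtP_oag g1 g3) => [l13|l31|<-{g3}].
  + move=> hu; have [c hc|{}u' ua h0] := trop_addeqP hu.
      rewrite trop_addl // => ->; exists (TPair c2 g1); first by rewrite trop_addl.
      exact/trop_addeq_level.
    move=> /(trop_add_above (y := TPair c3 g3) ua l13) wa.
    by exists (TPair c2 g1); [rewrite trop_addl|exact/trop_addeq_above].
  + move=> hu; have ua : tabove g3 u by apply: trop_add_above hu.
    by rewrite trop_addr // => ->; exists (TPair c3 g3); rewrite trop_addr.
  + case/trop_addeqP => [c hc|{}u ua h0].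
      case/trop_addeqP => [d hd|{}w wa h0].
        have [e he hde] := haddA_ex hc hd.
        have [e0|e0] := pselect (e = hzero).
          move: he hde; rewrite e0 hadd_0r => he /= /hunits_inj ->.
          exists TZero; last by [].
          exact/trop_addeq_above.
        exists (TPair (exist _ e e0) g1); exact/trop_addeq_level.
      have [e he h1] := haddA_ex hc h0.
      have e0 : e <> hzero.
        by rewrite (hopp_uniq h1); exact: hopp_neq0 (svalP c1).
      exists (TPair (exist _ e e0) g1); first exact/trop_addeq_level.
      exact/trop_addeq_above.
    rewrite trop_addr // => ->.
    have : (hzero ⊞ sval c3) (sval c3) by rewrite hadd0.
    move=> /(haddA_ex h0)[e he h1].
    have [e0|e0] := pselect (e = hzero).
      move: he h1; rewrite e0 hadd_0r => he /= /hunits_inj e3; subst c3.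
      exists TZero; last by [].
      exact/trop_addeq_above.
    exists (TPair (exist _ e e0) g1); exact/trop_addeq_level.
Qed.

Lemma trop_addA x y z :
  hyperlift trop_add (trop_add x y) [set z] =
  hyperlift trop_add [set x] (trop_add y z).
Proof.
apply/seteqP; split => w /=.
  move=> [u xyu [_ -> uzw]]; have [v yzv xvw] := trop_addA1 xyu uzw.
  by exists x => //; exists v.
move=> [_ -> [v]]; rewrite trop_addC => zyv; rewrite trop_addC => vxw.
have [u yxu zuw] := trop_addA1 zyv vxw.
by exists u; [rewrite trop_addC|exists z => //; rewrite trop_addC].
Qed.

Lemma trop_one_neq0 : trop_one <> TZero. Proof. by []. Qed.

Lemma trop_mul_neq0 x y : x <> TZero -> y <> TZero -> trop_mul x y <> TZero.
Proof. by case: x y => [|c1 g1] [|c2 g2]. Qed.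

Lemma trop_mulA x y z : x <> TZero -> y <> TZero -> z <> TZero ->
  trop_mul x (trop_mul y z) = trop_mul (trop_mul x y) z.
Proof.
case: x y z => [|c1 g1] [|c2 g2] [|c3 g3] //= _ _ _; rewrite addrA.
by congr TPair; apply: hunits_inj; apply: hmulA; exact: hunitP.
Qed.

Lemma trop_mulC x y : x <> TZero -> y <> TZero -> trop_mul x y = trop_mul y x.
Proof.
case: x y => [|c1 g1] [|c2 g2] //= _ _; rewrite addrC.
by congr TPair; apply: hunits_inj; apply: hmulC; exact: hunitP.
Qed.

Lemma trop_mul1 x : x <> TZero -> trop_mul trop_one x = x.
Proof.
case: x => [|c1 g1] //= _; rewrite add0r.
by congr TPair; apply: hunits_inj; apply: hmul1; exact: hunitP.
Qed.

Lemma trop_mulV x : x <> TZero ->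
  exists2 y, y <> TZero & trop_mul y x = trop_one.
Proof.
case: x => [|c1 g1] //= _; have [b b0 e] := hmulV (svalP c1).
exists (TPair (exist _ b b0) (- g1)%R) => //=; rewrite addNr.
by congr TPair; apply: hunits_inj.
Qed.

Lemma trop_mul0r x : trop_mul x TZero = TZero. Proof. by case: x. Qed.

Lemma trop_mulD x y z :
  trop_mul x @` trop_add y z = trop_add (trop_mul x y) (trop_mul x z).
Proof.
case: x => [|c g].
  rewrite [RHS]/=; apply/seteqP; split=> [_ [w _ <-] //|_ ->].
  by have [w hw] := trop_add_nonempty y z; exists w.
case: y => [|c2 g2]; first by rewrite trop_mul0r !trop_add0 image_set1.
case: z => [|c3 g3]; first by rewrite trop_mul0r !trop_add0r image_set1.
case: (ltgtP_oag g2 g3) => [l|l|<-{g3}].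
- by rewrite trop_addl // image_set1 trop_addl //= ltD2l_oag.
- by rewrite trop_addr // image_set1 trop_addr //= ltD2l_oag.
have mul0 : (sval c ⊙ sval c2 ⊞ sval c ⊙ sval c3) hzero <->
    (sval c2 ⊞ sval c3) hzero.
  rewrite -hmulD; split=> [[a ha a0]|h].
    have [e|an0] := pselect (a = hzero); first by rewrite e in ha.
    by have := hmul_neq0 (svalP c) an0.
  by exists hzero => //; rewrite hmulN0.
apply/seteqP; split.
  move=> _ [w + <-]; case/trop_addeqP => [d hd|{}w wa h0].
    by apply/trop_addeq_level => /=; rewrite -hmulD; exists (sval d).
  apply/trop_addeq_above; last exact/mul0.
  by case: w wa => [|d h] //=; rewrite ltD2l_oag.
move=> w; case/trop_addeqP => [d /=|{}w wa /mul0 h0].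
  rewrite -hmulD => -[a ha e].
  have a0 : a <> hzero by move=> a0; apply: (svalP d); rewrite -e a0 hmulN0.
  exists (TPair (exist _ a a0) g2); first exact/trop_addeq_level.
  by congr TPair; apply: hunits_inj.
case: w wa => [|d h] /= gh; first by exists TZero => //=; rewrite ltxx.
have [b b0 e] := hmulV (svalP c).
pose b' : hunits H := exist _ b b0.
exists (TPair (hunit_mul b' d) (- g + h)%R).
  apply/trop_addeq_above => //=.
  by rewrite -(ltD2l_oag g) addNKr.
rewrite /= addNKr; congr TPair; apply: hunits_inj => /=.
rewrite hmulA //; [|exact: hunitP..].
by rewrite (hmulC (svalP c) b0) e hmul1 //; exact: hunitP.
Qed.

HB.instance Definition _ := isHyperfield.Build (trop H G)
  trop_add_nonempty trop_addA trop_addC trop_add0 trop_addN trop_opp_uniq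
  trop_add_rev trop_one_neq0 trop_mul_neq0 trop_mulA trop_mulC trop_mul1
  trop_mulV trop_mulD (fun=> erefl).

End TropicalExtension.

Definition trop_map (H1 H2 : hyperfieldType) (f : {hyperhom H1 -> H2})
    (G : orderedAbelianGroupType) (x : trop H1 G) : trop H2 G :=
  if x is TPair c g then TPair (hunits_map f c) g else TZero.

Arguments trop_map {H1 H2} f G x.

Section TropicalMap.
Variables (H1 H2 : hyperfieldType) (f : {hyperhom H1 -> H2}).
Variable (G : orderedAbelianGroupType).

Lemma trop_mapD (x y : trop H1 G) :
  trop_map f G @` (x ⊞ y) `<=` trop_map f G x ⊞ trop_map f G y.
Proof.
have fD a b s : (a ⊞ b) s -> (f a ⊞ f b) (f s).
  by move=> h; apply: hhomD; exists s.
rewrite /hadd /=.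
case: x => [|c1 g1]; first by rewrite !trop_add0 image_set1.
case: y => [|c2 g2]; first by rewrite !trop_add0r image_set1.
case: (ltgtP_oag g1 g2) => [l|l|<-{g2}] _ [w + <-].
- by rewrite trop_addl // => ->; rewrite trop_addl.
- by rewrite trop_addr // => ->; rewrite trop_addr.
case/trop_addeqP => [d hd|{}w wa h0].
  by apply/trop_addeq_level; exact: fD.
apply/trop_addeq_above; first by case: w wa.
by rewrite /= -(hhom0 (s := f)); exact: fD.
Qed.

Lemma trop_mapM (x y : trop H1 G) :
  trop_map f G (x ⊙ y) = trop_map f G x ⊙ trop_map f G y.
Proof.
case: x y => [|c1 g1] [|c2 g2] //; rewrite /hmul /=.
by congr TPair; apply: hunits_inj; exact: hhomM.
Qed.

Lemma trop_map0 : trop_map f G hzero = hzero :> trop H2 G.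
Proof. by []. Qed.

Lemma trop_map1 : trop_map f G hone = hone :> trop H2 G.
Proof. by congr TPair; apply: hunits_inj; exact: hhom1. Qed.

HB.instance Definition _ := isHyperfieldHom.Build (trop H1 G) (trop H2 G)
  (trop_map f G) trop_mapD trop_mapM trop_map0 trop_map1.

End TropicalMap.

(* Main.v *)
(** Let [m] be the minimal valuation among the terms of [p] at a point of
    valuation [g].  On the elements of valuation at least [m], taking the
    coefficient in valuation [m] (and 0 above it) turns hypersums into
    hypersums.  Hence [(c, g)] is a root of [p] if and only if [c] is a root of
    the polynomial collecting the coefficients of the terms of valuation [m].
    As [f^Γ] preserves valuations, this initial form commutes with the
    push-forward, and a root [(b, g)] of the push-forward is lifted by lifting
    the root [b] of its initial form along [f]. *)
From HB Require Import structures.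
Require Import Defs.
From mathcomp Require Import all_boot all_order all_algebra.
From mathcomp Require Import finmap boolp classical_sets.

Set Implicit Arguments.
Unset Strict Implicit.
Unset Printing Implicit Defensive.

Import Order.TTheory GRing.Theory Num.Theory.

Local Open Scope fset_scope.
Local Open Scope fmap_scope.
Local Open Scope classical_set_scope.
Local Open Scope hyper_scope.

(** * Hypersums of subsets as a commutative monoid *)

Section HyperSum.
Variable H : hyperfieldType.
Implicit Types (A B C : set H) (a b c : H).

Let hsum := hyperlift (@hadd H).

Lemma hyperliftC : commutative hsum.
Proof.
by move=> A B; apply/seteqP; split=> w [a Aa [b Bb]];
  rewrite haddC => ?; exists b => //; exists a.
Qed.

Lemma hyperlift0 : left_id [set hzero] hsum.
Proof.
move=> A; apply/seteqP; split=> w.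
  by move=> [_ -> [b Ab]]; rewrite hadd0 => ->.
by move=> Aw; exists hzero => //; exists w => //; rewrite hadd0.
Qed.

Lemma hyperliftA : associative hsum.
Proof.
move=> A B C; apply/seteqP; split=> w.
  move=> [a Aa [v [b Bb [c Cc bcv]] avw]].
  have : hyperlift (@hadd H) [set a] (b ⊞ c) w by exists a => //; exists v.
  rewrite -haddA => -[u abu [_ -> ucw]].
  by exists u; [exists a => //; exists b|exists c].
move=> [u [a Aa [b Bb abu]] [c Cc ucw]].
have [v bcv avw] := haddA_ex abu ucw.
by exists a => //; exists v => //; exists b => //; exists c.
Qed.

End HyperSum.

HB.instance Definition _ (H : hyperfieldType) :=
  Monoid.isComLaw.Build (set H) [set hzero] (hyperlift (@hadd H))
    (@hyperliftA H) (@hyperliftC H) (@hyperlift0 H).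

(** * Evaluation of polynomials over larger sets of exponents *)

Section Evaluation.
Variable H : hyperfieldType.
Implicit Types (p : hpoly H) (a : H) (A : {fset nat}).

(** Terms are extended by 0 outside the support, so that polynomials with different supports can be
    summed over a common set of exponents. *)
Definition hterm p a (d : nat) : H :=
  if p.[? d] is Some c then sval c ⊙ hexp a d else hzero.

Lemma heval_fset p a A : (domf p `<=` A)%fset ->
  heval p a = \big[hyperlift (@hadd H)/[set hzero]]_(d <- A) [set hterm p a d].
Proof.
move=> pA; rewrite -(big_fset_incl _ pA) => [|d _ dp]; last first.
  by rewrite /hterm not_fnd.
rewrite big_seq_fsetE; apply: eq_bigr => d _.
by rewrite /hterm (in_fnd (valP d)) getfE.
Qed.

Lemma hexp0 n : hexp (hzero : H) n.+1 = hzero.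
Proof. by rewrite /hexp /= hmul0. Qed.

Lemma hmulr1 a : a <> hzero -> a ⊙ hone = a.
Proof. by move=> a0; rewrite hmulC ?hmul1 //; exact: hone_neq0. Qed.

(** Only the constant term survives at 0, and its coefficient is nonzero. The criterion depends on
    the support alone, which a push-forward preserves. *)
Lemma hroots0 p : hroots p hzero <-> 0 \notin domf p.
Proof.
have term0 d : d != 0 -> [set hterm p hzero d] = [set hzero].
  by case: d => // n _; rewrite /hterm; case: fnd => // c; rewrite hexp0 hmulN0.
rewrite /hroots /= (@heval_fset _ _ (domf p)) //; split => [|p0].
  apply: contraPN => p0.
  rewrite (big_fsetD1 0%N) //= big1_fset => [|d]; last first.
    by rewrite in_fsetD1 => /andP[/term0].
  rewrite Monoid.mulm1 /hterm in_fnd /= hmulr1; last exact: hunitP.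
  by move/esym; exact: hunitP.
rewrite big1_fset // => d dp _; apply: term0.
by apply: contraNneq p0 => <-.
Qed.

End Evaluation.

Lemma fnd_hpush (H1 H2 : hyperfieldType) (f : {hyperhom H1 -> H2})
    (p : hpoly H1) d : (hpush f p).[? d] = omap (hunits_map f) p.[? d].
Proof.
case: (fndP p) => [dp|dp]; last by rewrite not_fnd.
by rewrite in_fnd ffunE; congr (Some (hunits_map f (p _))); exact: val_inj.
Qed.

(** * Residues at a fixed valuation *)

Section Residue.
Variables (H : hyperfieldType) (G : orderedAbelianGroupType).
Implicit Types (m g : G) (x y z : trop H G) (p : hpoly (trop H G)).

Definition tatleast m x : Prop := if x is TPair _ h then (m <= h)%R else True.

Definition residue m x : H :=
  if x is TPair c h then if h == m then sval c else hzero else hzero.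

Lemma tatleastP m x :
  tatleast m x -> tabove m x \/ exists c, x = TPair c m.
Proof.
case: x => [|c h] /=; first by left.
by rewrite le_eqVlt => /orP[/eqP <-|]; [right; exists c|left].
Qed.

Lemma tabove_atleast m x : tabove m x -> tatleast m x.
Proof. by case: x => //= c h; exact: ltW. Qed.

Lemma residue_above m x : tabove m x -> residue m x = hzero.
Proof. by case: x => //= c h mh; rewrite gt_eqF. Qed.

Lemma residue_level m c : residue m (TPair c m) = sval c.
Proof. by rewrite /= eqxx. Qed.

Lemma trop_haddE x y : x ⊞ y = trop_add x y. Proof. by []. Qed.

Lemma tatleastD m x y z :
  tatleast m x -> tatleast m y -> (x ⊞ y) z -> tatleast m z.
Proof.
rewrite trop_haddE => mx my; case: (tatleastP mx) => [xa|[c ->]];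
  case: (tatleastP my) => [ya|[d ->]].
- by move=> h; apply/tabove_atleast/(trop_add_above xa ya h).
- by rewrite trop_addr // => -> /=.
- by rewrite trop_addl // => -> /=.
- by case/trop_addeqP => [e _ /=|w /tabove_atleast].
Qed.

(** If both valuations are [m], the sum leaves level [m] only when the coefficients can add up to 0,
    and the elements above [m] then account for the residue 0. A summand above [m] is absorbed by
    one at level [m], just as 0 is neutral in [H]. *)
Lemma residueD m x y : tatleast m x -> tatleast m y ->
  residue m @` (x ⊞ y) = residue m x ⊞ residue m y.
Proof.
rewrite trop_haddE => mx my; case: (tatleastP mx) => [xa|[c ->]];
  case: (tatleastP my) => [ya|[d ->]].
- rewrite !residue_above // hadd0; have [w xyw] := trop_add_nonempty x y.
  apply/seteqP; split=> [_ [z xyz <-]|_ ->].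
    exact: residue_above (trop_add_above xa ya xyz).
  by exists w => //; exact: residue_above (trop_add_above xa ya xyw).
- by rewrite trop_addr // image_set1 (residue_above xa) hadd0.
- by rewrite trop_addl // image_set1 (residue_above ya) hadd_0r.
rewrite !residue_level; apply/seteqP; split=> [_ [z + <-]|a cda].
  case/trop_addeqP => [e cde|{}z za cd0]; first by rewrite residue_level.
  by rewrite residue_above.
have [a0|a0] := pselect (a = hzero).
  by move: cda; rewrite a0 => ?; exists TZero; first exact/trop_addeq_above.
exists (TPair (exist _ a a0) m); last by rewrite residue_level.
exact/trop_addeq_level.
Qed.

(** The lower bound is carried through the same induction because [residueD] requires it for the
    elements of the tail sum. *)
Lemma residue_sum (I : eqType) m (s : seq I) (F : I -> trop H G) :
  {in s, forall i, tatleast m (F i)} ->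
  (\big[hyperlift (@hadd (trop H G))/[set hzero]]_(i <- s) [set F i]
    `<=` tatleast m) /\
  residue m @`
    (\big[hyperlift (@hadd (trop H G))/[set hzero]]_(i <- s) [set F i]) =
  \big[hyperlift (@hadd H)/[set hzero]]_(i <- s) [set residue m (F i)].
Proof.
elim: s => [|i s IHs] mF; first by rewrite !big_nil image_set1; split=> // _ ->.
have mi : tatleast m (F i) by apply: mF; rewrite mem_head.
have /IHs[mS eS] : {in s, forall j, tatleast m (F j)}.
  by move=> j js; apply: mF; rewrite inE js orbT.
rewrite !big_cons -eS; set S := (\big[_/_]_(j <- s) [set F j]) in mS *.
split=> [z [_ -> [y Sy]]|]; first by apply: tatleastD; last exact: mS.
apply/seteqP; split=> [_ [z [_ -> [y Sy iyz]] <-]|w [_ -> [_ [y Sy <-]]]].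
  exists (residue m (F i)) => //; exists (residue m y); first by exists y.
  by rewrite -residueD; [exists z| |exact: mS].
rewrite -residueD; [|by []|exact: mS].
by move=> [z iyz <-]; exists z => //; exists (F i) => //; exists y.
Qed.

(* Without a term of valuation [m], the right-to-left implication fails. *)
Lemma trop_sum_zero (I : choiceType) m (A : {fset I}) (F : I -> trop H G) :
  {in A, forall i, tatleast m (F i)} ->
  (exists2 i, i \in A & exists c, F i = TPair c m) ->
  (\big[hyperlift (@hadd (trop H G))/[set hzero]]_(i <- A) [set F i]) hzero <->
  (\big[hyperlift (@hadd H)/[set hzero]]_(i <- A) [set residue m (F i)]) hzero.
Proof.
move=> mF [i iA [c Fi]]; split=> [S0|].
  by have [_ <-] := residue_sum mF; exists hzero.
have mF' : {in (A `\ i)%fset, forall j, tatleast m (F j)}.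
  by move=> j; rewrite in_fsetD1 => /andP[_]; exact: mF.
have [mS /esym eS] := residue_sum mF'.
rewrite (big_fsetD1 i) // eS [X in _ -> X _](big_fsetD1 i) //= Fi residue_level.
move=> [_ -> [_ [z Sz <-] cz0]].
exists (TPair c m) => //; exists z => //.
(* If [z] were above [m], its residue would be 0 and [c] would have to vanish. So [z] lies at level
   [m], and adding [TPair c m] to it can give [TZero]. *)
have := svalP c; case: (tatleastP (mS _ Sz)) cz0 => [za|[d ->]].
  by rewrite (residue_above za) hadd_0r => <-.
by rewrite residue_level => cd0 _; apply/trop_addeq_above.
Qed.

End Residue.

(** * Initial forms of tropical polynomials *)

Section InitialForm.
Variables (H : hyperfieldType) (G : orderedAbelianGroupType).
Implicit Types (m g : G) (c : hunits H) (u : hunits (trop H G)).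
Implicit Types (p : hpoly (trop H G)).

Definition tcoef u : hunits H :=
  if sval u is TPair c _ then c else hunit_one H.

Definition tval u : G := if sval u is TPair _ g then g else 0%R.

Lemma tcoef_tval u : sval u = TPair (tcoef u) (tval u).
Proof. by case: u => -[u0|c g u0] //=; case: u0. Qed.

Definition term_val p g (d : nat) : G :=
  if p.[? d] is Some u then (tval u + g *+ d)%R else 0%R.

(** [reducef] drops the exponents sent to [None], since a polynomial stores nonzero coefficients
    only. *)
Definition initial_form p g m : hpoly H :=
  reducef [fmap d : domf p =>
    if term_val p g (val d) == m then Some (tcoef (p d)) else None].

Lemma fnd_initial_form p g m d : (initial_form p g m).[? d] =
  obind (fun u => if term_val p g d == m then Some (tcoef u) else None) p.[? d].
Proof.
rewrite fnd_reducef; case: (fndP p) => [dp|dp]; last by rewrite not_fnd.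
by rewrite in_fnd ffunE /=; case: ifP => // _; congr (Some (tcoef (p _)));
  exact: val_inj.
Qed.

Lemma domf_initial_form p g m : (domf (initial_form p g m) `<=` domf p)%fset.
Proof.
by apply/fsubsetP => d; rewrite -!fndSome fnd_initial_form; case: fndP.
Qed.

Lemma hexp_trop c g d : exists2 e : hunits H,
  hexp (TPair c g : trop H G) d = TPair e (g *+ d)%R & sval e = hexp (sval c) d.
Proof.
elim: d => [|d [e ed eE]]; first by exists (hunit_one H).
by exists (hunit_mul c e); rewrite /hexp /= -/(hexp _ _) ?eE // ed mulrS.
Qed.

(** The same unit [e], the coefficient times a power of [c], serves the tropical term and the
    initial forms for all [m]. *)
Lemma hterm_trop p c g d : d \in domf p ->
  exists2 e : hunits H, hterm p (TPair c g) d = TPair e (term_val p g d) &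
  forall m, hterm (initial_form p g m) (sval c) d =
    if term_val p g d == m then sval e else hzero.
Proof.
move=> dp; have [e ed eE] := hexp_trop c g d.
rewrite /hterm /term_val (in_fnd dp); set u := p.[dp].
exists (hunit_mul (tcoef u) e); first by rewrite ed tcoef_tval.
move=> m; rewrite fnd_initial_form /term_val in_fnd /= -/u.
by case: ifP => //= _; rewrite eE.
Qed.

Lemma hroots_initial_form p c g m :
  {in domf p, forall d, m <= term_val p g d}%R ->
  (exists2 d, d \in domf p & term_val p g d = m) ->
  hroots p (TPair c g) <-> hroots (initial_form p g m) (sval c).
Proof.
move=> mp [d0 d0p d0m]; rewrite /hroots /=.
rewrite (heval_fset _ (fsubset_refl _)).
(* The initial form is also summed over the support of [p], so that the two sums can be compared
   term by term. *)
rewrite (heval_fset _ (domf_initial_form p g m)).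
rewrite (@trop_sum_zero _ _ _ m); last 2 first.
- by move=> d dp; have [e -> _] := hterm_trop c g dp; exact: mp.
- exists d0 => //; have [e -> _] := hterm_trop c g d0p.
  by exists e; rewrite d0m.
suff -> : \big[hyperlift (@hadd H)/[set hzero]]_(d <- domf p)
      [set residue m (hterm p (TPair c g) d)] =
    \big[hyperlift (@hadd H)/[set hzero]]_(d <- domf p)
      [set hterm (initial_form p g m) (sval c) d] by [].
apply: eq_big_seq => d dp.
by have [e -> ->] := hterm_trop c g dp.
Qed.

Lemma term_val_min p g : domf p != fset0 ->
  exists2 d0, d0 \in domf p &
    {in domf p, forall d, term_val p g d0 <= term_val p g d}%R.
Proof.
case/fset0Pn => i ip.
(* The order on [G] is partial as a structure, so its totality enters as pairwise comparability. *)
have cmp : {in xpredT &, forall d e : domf p,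
    (term_val p g (val d) >=< term_val p g (val e))%R}.
  by move=> d e _ _; exact: le_total_oag.
case: (@comparable_arg_minP _ _ _ [` ip] xpredT
  (fun d : domf p => term_val p g (val d)) isT cmp) => d0 _ min0.
by exists (val d0) => [|d dp]; [exact: valP|exact: (min0 [` dp] isT)].
Qed.

End InitialForm.

(** * Compatibility of initial forms with push-forward *)

Section PushForward.
Variables (H1 H2 : hyperfieldType) (f : {hyperhom H1 -> H2}).
Variable G : orderedAbelianGroupType.
Implicit Types (g m : G) (p : hpoly (trop H1 G)).

Let fG : {hyperhom trop H1 G -> trop H2 G} := trop_map f G.

Lemma tval_trop_map (u : hunits (trop H1 G)) : tval (hunits_map fG u) = tval u.
Proof. by rewrite /tval /= tcoef_tval. Qed.

Lemma tcoef_trop_map (u : hunits (trop H1 G)) :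
  tcoef (hunits_map fG u) = hunits_map f (tcoef u).
Proof. by rewrite {1}/tcoef /= tcoef_tval. Qed.

Lemma term_val_hpush p g : term_val (hpush fG p) g =1 term_val p g.
Proof.
move=> d; rewrite /term_val fnd_hpush.
by case: fnd => //= u; rewrite tval_trop_map.
Qed.

Lemma initial_form_hpush p g m :
  initial_form (hpush fG p) g m = hpush f (initial_form p g m).
Proof.
apply/fmapP => d; rewrite fnd_hpush !fnd_initial_form fnd_hpush term_val_hpush.
by case: fnd => //= u; case: ifP => //= _; rewrite tcoef_trop_map.
Qed.

End PushForward.

(** * Lifting roots along the tropical extension *)

Theorem proposition3p15 (H1 H2 : hyperfieldType) (f : {hyperhom H1 -> H2})
    (hf : relatively_algebraically_closed f) (G : orderedAbelianGroupType) :
  relatively_algebraically_closed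
    (trop_map f G : {hyperhom trop H1 G -> trop H2 G}).
Proof.
have [f_surj f_lift] := hf.
(* A preimage of a unit is nonzero because [f] sends 0 to 0, so it is the coefficient of a point of
   any valuation [g]. *)
have lift_unit g (c : hunits H2) a : f a = sval c ->
    exists2 a' : hunits H1, sval a' = a & trop_map f G (TPair a' g) = TPair c g.
  move=> fa; have a0 : a <> hzero.
    by move=> a0; apply: (svalP c); rewrite -fa a0 hhom0.
  by exists (exist _ a a0) => //=; congr TPair; apply: hunits_inj.
split=> [[|c g]|p [|c g] root_b].
- by exists TZero.
- have [a /(lift_unit g)[a' _ <-]] := f_surj (sval c).
  by exists (TPair a' g).
- by exists TZero => //; apply/hroots0; exact: (proj1 (hroots0 _) root_b).
(* The empty polynomial has no minimal valuation, but every point is a root of it, so surjectivity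
   of [f] suffices. *)
have [p0|p0] := eqVneq (domf p) fset0.
  have [a /(lift_unit g)[a' _ <-]] := f_surj (sval c).
  exists (TPair a' g) => //.
  by rewrite /hroots /= (heval_fset _ (fsubset_refl _)) p0 big_seq_fset0.
have [d0 d0p min0] := term_val_min g p0; pose m := term_val p g d0.
have at_m : exists2 d, d \in domf p & term_val p g d = m by exists d0.
(* The same [m] is minimal for the push-forward, whose term valuations agree with those of [p]. *)
have : hroots (hpush f (initial_form p g m)) (sval c).
  rewrite -initial_form_hpush; apply: (hroots_initial_form _ _ _).1 root_b.
    by move=> d dp; rewrite term_val_hpush; exact: min0.
  by exists d0 => //; rewrite term_val_hpush.
move=> /f_lift[a /(lift_unit g)[a' <- <-] root_a].
by exists (TPair a' g) => //; apply/(hroots_initial_form _ min0 at_m).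
Qed.
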